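(* Let $\alpha\in(0,2)$, $\tau>0$, $\sigma_G>0$, fix a time $t$, a state $X_t\in\mathbb{R}$, and coefficients $A_t<0$, $B_t\in\mathbb{R}$, and let $\phi_t(x)=A_tx^2+B_tx$. For $r>0$ let $$C(r,t,X_t)=\int_{\mathbb{R}}e^{\phi_t(X_t+y)-\phi_t(X_t)}\,\mathcal{N}(y;0,r^2\sigma_G^2)\,dy,$$ where $\mathcal{N}(y;0,s^2)$ is the density at $y$ of the centred Gaussian law with variance $s^2$, and let $K_1=2A_tX_t+B_t$. Then for all $r>0$, $$C(r,t,X_t)\le M(t,X_t):=\exp\!\left(\frac{K_1^2}{4|A_t|}\right).$$ Consequently the tilted mixing measure, i.e. the probability density $\tilde\pi_\tau(r,t,X_t)\propto C(r,t,X_t)\,r^{-1-\alpha}\mathbf{1}_{r\ge\tau}$, admits an exact rejection sampler with proposal density $q(r)\propto r^{-1-\alpha}\mathbf{1}_{r\ge\tau}$: if $r^*\sim q$ is proposed and accepted with probability $C(r^*,t,X_t)/M(t,X_t)\in[0,1]$, then the law of an accepted proposal is exactly $\tilde\pi_\tau(\cdot,t,X_t)$.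
   Context: The constant $C(r,t,X_t)$ has the closed form $C(r,t,X_t)=\dfrac{1}{\sqrt{-2K_2r^2\sigma_G^2}}\exp\!\left(-\dfrac{K_1^2}{4K_2}\right)$ with $K_2=A_t-\dfrac{1}{2r^2\sigma_G^2}<0$. In a rejection sampler, independent proposals are drawn until one is accepted. *)

(* Defs.v *)
From HB Require Import structures.
From mathcomp Require Import all_boot all_order all_algebra.
From mathcomp Require Import all_classical all_reals all_analysis.
Set Implicit Arguments.
Unset Strict Implicit.
Unset Printing Implicit Defensive.
Import Order.TTheory GRing.Theory Num.Theory.
Import numFieldNormedType.Exports.
Local Open Scope classical_set_scope.
Local Open Scope ring_scope.

(* MathComp-Analysis. *)

Section densities.
Context {R : realType}.
Implicit Types f : R -> R.

Definition is_pdf f : Prop :=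
  [/\ measurable_fun [set: R] f, (forall x, 0 <= f x) &
      (\int[lebesgue_measure]_x (f x)%:E = 1)%E].

(* The density proportional to f; when f has integral 0 or an infinite
   integral the result is the zero function, which is not an [is_pdf]. *)
Definition normalized f : R -> R :=
  fun x => f x / \int[lebesgue_measure]_y f y.

Definition law_of_density f (A : set R) : \bar R :=
  (\int[lebesgue_measure]_(x in A) (f x)%:E)%E.

End densities.

Section mixing.
Context {R : realType}.
Variables (alpha tau sigma A B X : R).

Definition phi (x : R) : R := A * x ^+ 2 + B * x.

(* [normal_pdf m s] takes the standard deviation s, here r * sigma. *)
Definition tilt_integrand (r y : R) : R :=
  expR (phi (X + y) - phi X) * normal_pdf 0 (r * sigma) y.

Definition tilt_C (r : R) : R :=
  \int[lebesgue_measure]_y tilt_integrand r y.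

Definition tilt_K1 : R := 2 * A * X + B.

Definition tilt_M : R := expR (tilt_K1 ^+ 2 / (4 * `|A|)).

Definition truncated_power (r : R) : R :=
  r `^ (- 1 - alpha) * \1_`[tau, +oo[ r.

Definition proposal_density : R -> R := normalized truncated_power.

Definition tilted_density : R -> R :=
  normalized (fun r => tilt_C r * truncated_power r).

Definition acceptance_probability (r : R) : R := tilt_C r / tilt_M.

End mixing.

Section rejection_sampling.
Context {R : realType} {d : measure_display} {T : measurableType d}.
Variable P : probability T R.

Definition mutually_independent {d' : measure_display}
    {T' : measurableType d'} (Z : nat -> T -> T') : Prop :=
  forall (s : seq nat) (D : nat -> set T'), uniq s ->
    (forall i, measurable (D i)) ->
    P (\bigcap_(i in [set` s]) (Z i @^-1` D i)) =
    (\prod_(i <- s) P (Z i @^-1` D i))%E.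

(* One round: rho is drawn from the density q and, given rho = r, is accepted
   with probability a r, i.e. a(rho) is the conditional probability of
   acceptance given rho. *)
Definition proposal_round (q a : R -> R)
    (rho : {RV P >-> R}) (acc : {RV P >-> bool}) : Prop :=
  (forall E : set R, measurable E ->
     distribution P rho E = law_of_density q E) /\
  (forall E : set R, measurable E ->
     P (rho @^-1` E `&` acc @^-1` [set true]) =
     (\int[distribution P rho]_(r in E) (a r)%:E)%E).

Definition rejection_sampler (q a : R -> R)
    (rho : nat -> {RV P >-> R}) (acc : nat -> {RV P >-> bool}) : Prop :=
  (forall n, proposal_round q a (rho n) (acc n)) /\
  mutually_independent (fun n w => (rho n w, acc n w)).

(* The first accepted proposal; the value 0 is used only if no proposal is
   ever accepted. *)
Definition sampler_output (rho : nat -> {RV P >-> R})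
    (acc : nat -> {RV P >-> bool}) (w : T) : R :=
  if pselect (exists n, acc n w) is left ex_acc then rho (ex_minn ex_acc) w
  else 0.

Definition conditional_probability (E F : set T) : \bar R :=
  (P (E `&` F) / P F)%E.

End rejection_sampling.

(* Main.v *)
(* Completing the square gives phi(X + y) - phi(X) <= K1^2 / (4 |A|), and the Gaussian
   density has total mass 1, so C <= M. A proposal falling in E is accepted with
   probability int_E a q, where a q = C(r) r^(-1-alpha) 1_(r >= tau) up to a constant
   factor; normalizing gives the target. Independent rounds turn this into a geometric
   series: the first acceptance occurs at round n with a value in E with probability
   (1 - p)^n int_E a q, where p = int a q > 0.

   A sampler exists on the space of fair coin sequences, which carries the law of the
   binary digits of a uniform variable. Splitting a sequence into its even and odd terms
   gives two independent copies, hence infinitely many independent uniform variables;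
   the proposal is tau U^(-1/alpha), and it is accepted when a second uniform variable
   is at most a of the proposal. *)
Require Import Defs.
From HB Require Import structures.
From mathcomp Require Import all_boot all_order all_algebra.
From mathcomp Require Import all_classical all_reals all_analysis.
From mathcomp Require Import measurable_realfun ring lra.
Set Implicit Arguments.
Unset Strict Implicit.
Unset Printing Implicit Defensive.
Import Order.TTheory GRing.Theory Num.Theory.
Import numFieldNormedType.Exports.
Local Open Scope classical_set_scope.
Local Open Scope ring_scope.

(** * Normalizing a nonnegative function to a probability density *)

Section normalized_density.
Context {R : realType}.
Notation mu := (@lebesgue_measure R).
Implicit Types f : R -> R.

Lemma normalized_scale f (k : R) : k != 0 ->
  mu.-integrable [set: R] (EFin \o f) ->
  normalized (fun x => k * f x) = normalized f.
Proof.
move=> k0 fi; apply/funext => x; rewrite /normalized RintegralZl//.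
by rewrite invfM mulrACA divff// mul1r.
Qed.

(** The real integral is the [fine] part of the extended one and [fine] sends both infinities to 0,
    so positivity rules them out. *)
Lemma Rintegral_gt0_fin_num f : 0 < \int[mu]_y f y ->
  (\int[mu]_y (f y)%:E)%E \is a fin_num.
Proof. by rewrite /Rintegral; case: (integral _ _ _) => //=; rewrite ltxx. Qed.

Lemma law_of_normalized f : measurable_fun [set: R] f ->
  (forall x, 0 <= f x) -> (0 < \int[mu]_y f y) ->
  forall E : set R, measurable E ->
  law_of_density (normalized f) E =
    (law_of_density f E / (\int[mu]_y (f y)%:E))%E.
Proof.
move=> mf f0 If E mE.
rewrite /law_of_density /normalized.
have fin := Rintegral_gt0_fin_num If.
rewrite -(fineK fin) -/(Rintegral _ _ _) inver gt_eqF// muleC.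
rewrite -ge0_integralZl//.
- by apply: eq_integral => x _; rewrite -EFinM mulrC.
- exact/measurable_EFinP/measurable_funTS.
- by move=> x _; rewrite lee_fin.
- by rewrite lee_fin invr_ge0 ltW.
Qed.

Lemma is_pdf_normalized f : measurable_fun [set: R] f ->
  (forall x, 0 <= f x) -> (0 < \int[mu]_y f y) -> is_pdf (normalized f).
Proof.
move=> mf f0 If; split.
- exact: measurable_funM.
- by move=> x; rewrite /normalized divr_ge0// ltW.
- rewrite -[LHS]/(law_of_density (normalized f) [set: R]) law_of_normalized//.
  have fin := Rintegral_gt0_fin_num If.
  rewrite /law_of_density divee//.
  by apply/eqP => I0; move: If; rewrite /Rintegral I0 ltxx.
Qed.

End normalized_density.

(** * The constant C: bound by M and measurability in r *)

Section tilt.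
Context {R : realType}.
Variables (sigma A B X : R).
Hypothesis A_lt0 : A < 0.
Notation mu := (@lebesgue_measure R).

Lemma phi_le (y : R) :
  phi A B (X + y) - phi A B X <= tilt_K1 A B X ^+ 2 / (4 * `|A|).
Proof.
rewrite ltr0_norm// ler_pdivlMr; last by rewrite mulr_gt0// oppr_gt0.
rewrite /phi /tilt_K1 -subr_ge0.
(* After clearing the denominator -4A, the gap between the two sides is the square of 2Ay + K1. *)
rewrite [leRHS](_ : _ = (2 * A * y + (2 * A * X + B)) ^+ 2) ?sqr_ge0//; ring.
Qed.

Lemma tilt_M_gt0 : 0 < tilt_M A B X.
Proof. exact: expR_gt0. Qed.

Lemma tilt_integrand_ge0 r y : 0 <= tilt_integrand sigma A B X r y.
Proof. by rewrite mulr_ge0 ?expR_ge0 ?normal_pdf_ge0. Qed.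

Lemma tilt_integrand_le r y :
  tilt_integrand sigma A B X r y <= tilt_M A B X * normal_pdf 0 (r * sigma) y.
Proof. by rewrite ler_wpM2r ?normal_pdf_ge0// ler_expR phi_le. Qed.

(** On nonnegative reals the inverse is the power with exponent -1, also at 0 where both give 0, and
    powers are measurable. *)
Lemma measurable_invr_ge0 d (T : measurableType d) (f : T -> R) :
  (forall x, 0 <= f x) -> measurable_fun [set: T] f ->
  measurable_fun [set: T] (fun x => (f x)^-1).
Proof.
move=> f0 mf; under eq_fun do rewrite -powR_inv1//.
exact: measurableT_comp (measurable_powR _) mf.
Qed.

(** Joint measurability in (r, y) is what Tonelli's theorem asks for in [measurable_tilt_C]. *)
Lemma measurable_tilt_integrand2 :
  measurable_fun [set: R * R] (fun z => tilt_integrand sigma A B X z.1 z.2).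
Proof.
have m1 : measurable_fun [set: R * R] (fun z : R * R => z.1) by exact: measurable_fst.
have m2 : measurable_fun [set: R * R] (fun z : R * R => z.2) by exact: measurable_snd.
have ms : measurable_fun [set: R * R] (fun z : R * R => z.1 * sigma).
  exact: measurable_funM.
apply: measurable_funM.
  apply: measurableT_comp => //; apply: measurable_funB => //.
  have mX : measurable_fun [set: R * R] (fun z : R * R => X + z.2).
    exact: measurable_funD.
  by apply: measurable_funD; apply: measurable_funM => //; exact: measurable_funX.
(* [normal_pdf] branches on a zero standard deviation, where it is an indicator function. *)
rewrite /normal_pdf; apply: measurable_fun_ifT.
- exact: measurable_fun_eqr.
- by apply: measurableT_comp => //; exact: measurable_indic.
- apply: measurable_funM.
  apply: measurable_invr_ge0; first by move=> ?; exact: sqrtr_ge0.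
    apply: measurableT_comp.
      exact: (continuous_measurable_fun (@sqrt_continuous R)).
    under eq_fun do rewrite -mulr_natr.
    by do !apply: measurable_funM => //; exact: measurable_funX.
  apply: measurableT_comp => //; apply: measurable_funM.
    by apply: measurableT_comp => //; apply: measurable_funX; exact: measurable_funB.
  apply: measurable_invr_ge0.
    by move=> z; rewrite mulrn_wge0 ?sqr_ge0.
  under eq_fun do rewrite -mulr_natr.
  by apply: measurable_funM => //; exact: measurable_funX.
Qed.

Lemma measurable_tilt_integrand r :
  measurable_fun [set: R] (tilt_integrand sigma A B X r).
Proof.
apply: (measurableT_comp (f := fun z => tilt_integrand sigma A B X z.1 z.2)
  measurable_tilt_integrand2 (g := fun y => (r, y))).
exact: measurable_fun_pair.
Qed.

(** The integrand is dominated by M times a Gaussian density. Integrability lets the real-valued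
    integral defining C be read as an extended one. *)
Lemma integrable_tilt_integrand r :
  mu.-integrable [set: R] (EFin \o tilt_integrand sigma A B X r).
Proof.
apply: (le_integrable _ _ _ (integrableZl measurableT (tilt_M A B X)
  (integrable_normal_pdf 0 (r * sigma)))) => //.
  by apply/measurable_EFinP; exact: measurable_tilt_integrand.
move=> y _ /=; rewrite lee_fin ger0_norm ?tilt_integrand_ge0//.
rewrite ger0_norm ?tilt_integrand_le//.
exact: le_trans (tilt_integrand_ge0 _ _) (tilt_integrand_le _ _).
Qed.

Lemma tilt_CE r : (tilt_C sigma A B X r)%:E =
  (\int[mu]_y (tilt_integrand sigma A B X r y)%:E)%E.
Proof.
rewrite /tilt_C /Rintegral fineK//.
exact: integrable_fin_num (integrable_tilt_integrand r).
Qed.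

(** The pointwise bound is integrated against a density of mass 1. [normal_pdf] keeps mass 1 at
    standard deviation 0, so the acceptance probability stays below 1 on the whole line. *)
Lemma tilt_C_le r : tilt_C sigma A B X r <= tilt_M A B X.
Proof.
rewrite -lee_fin tilt_CE.
apply: (@le_trans _ _
  (\int[mu]_y ((tilt_M A B X)%:E * (normal_pdf 0 (r * sigma) y)%:E))%E).
  apply: ge0_le_integral => //.
  - by move=> y _; rewrite lee_fin tilt_integrand_ge0.
  - by apply/measurable_EFinP; exact: measurable_tilt_integrand.
  - apply: emeasurable_funM => //; apply/measurable_EFinP.
    exact: measurable_normal_pdf.
  - by move=> y _; rewrite -EFinM lee_fin tilt_integrand_le.
rewrite ge0_integralZl//.
- by rewrite integral_normal_pdf mule1.
- by apply/measurable_EFinP; exact: measurable_normal_pdf.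
- by move=> y _; rewrite lee_fin normal_pdf_ge0.
- by rewrite lee_fin ltW// tilt_M_gt0.
Qed.

Lemma tilt_C_ge0 r : 0 <= tilt_C sigma A B X r.
Proof. by apply: Rintegral_ge0 => y _; exact: tilt_integrand_ge0. Qed.

Lemma measurable_tilt_C : measurable_fun [set: R] (tilt_C sigma A B X).
Proof.
apply/measurable_EFinP.
have := @measurable_fun_fubini_tonelli_F _ _ _ _ R mu
  (fun z => (tilt_integrand sigma A B X z.1 z.2)%:E).
have -> : fubini_F mu (fun z => (tilt_integrand sigma A B X z.1 z.2)%:E) =
  EFin \o tilt_C sigma A B X.
  by apply/funext => r /=; rewrite tilt_CE.
apply; first by apply/measurable_EFinP; exact: measurable_tilt_integrand2.
by move=> z; rewrite lee_fin tilt_integrand_ge0.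
Qed.

End tilt.

(** * The truncated power law and its tail *)

Section power_law.
Context {R : realType}.
Variables (alpha tau : R).
Hypotheses (alpha_gt0 : 0 < alpha) (tau_gt0 : 0 < tau).
Notation mu := (@lebesgue_measure R).

Lemma powRN_cvg0 : x `^ (- alpha) @[x --> +oo] --> (0 : R).
Proof.
apply/cvgrPdist_lt => e e0; near=> x.
(* The threshold solves x^(-alpha) = e; beyond it the decreasing power is below e. *)
have b0 : 0 < e `^ (- alpha^-1) by exact: powR_gt0.
have x0 : e `^ (- alpha^-1) < x by near: x; exact: nbhs_pinfty_gt.
rewrite sub0r normrN ger0_norm ?powR_ge0//.
have -> : e = (e `^ (- alpha^-1)) `^ (- alpha).
  by rewrite -powRrM mulrNN mulVf ?gt_eqF// powRr1// ltW.
have x_gt0 := lt_trans b0 x0.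
rewrite [ltLHS]powRN [ltRHS]powRN ltf_pV2 ?posrE ?powR_gt0//.
by rewrite gt0_ltr_powR// nnegrE ltW.
Unshelve. all: by end_near. Qed.

(** Fundamental theorem of calculus on a half-line: the antiderivative -r^(-alpha)/alpha tends to 0
    at infinity. *)
Lemma integral_powR_tail (x : R) : 0 < x ->
  (\int[mu]_(r in `[x, +oo[) (r `^ (- 1 - alpha))%:E =
   (x `^ (- alpha) / alpha)%:E)%E.
Proof.
move=> x0.
have d (r : R) : 0 < r -> is_derive r (1 : R) (fun r : R => - alpha^-1 * r `^ (- alpha))
    (r `^ (- 1 - alpha)).
  move=> r0; have := is_derive1_powR (- alpha) r0.
  move=> /(is_deriveZ (- alpha^-1)).
  rewrite /GRing.scale/= mulrA mulrNN mulVf ?gt_eqF// mul1r.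
  by rewrite [in - 1 - alpha]addrC.
have cF (r : R) : 0 < r ->
    {for r, continuous (fun r : R => - alpha^-1 * r `^ (- alpha))}.
  move=> r0; apply: differentiable_continuous; apply/derivable1_diffP.
  by have [] := d r r0.
have dpw (r : R) : 0 < r -> {for r, continuous (fun r : R => r `^ (- 1 - alpha))}.
  move=> r0; apply: differentiable_continuous; apply/derivable1_diffP.
  by have [] := is_derive1_powR (- 1 - alpha) r0.
rewrite (@ge0_continuous_FTC2y R _ (fun r : R => - alpha^-1 * r `^ (- alpha)) x 0).
- by rewrite -EFinB sub0r mulNr opprK mulrC.
- by move=> *; exact: powR_ge0.
- apply: continuous_in_subspaceT => r; rewrite inE/= in_itv/= andbT => xr.
  exact: dpw (lt_le_trans x0 xr).
- by rewrite -(mulr0 (- alpha^-1)); apply: cvgMr; exact: powRN_cvg0.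
- by move=> r xr; have [] := d r (lt_trans x0 xr).
- by apply: cvg_at_right_filter; exact: cF.
- move=> r; rewrite in_itv/= andbT => xr.
  by rewrite derive1E; apply: derive_val; exact: d (lt_trans x0 xr).
Qed.

Notation tp := (truncated_power alpha tau).

Lemma truncated_power_ge0 r : 0 <= tp r.
Proof. by rewrite mulr_ge0 ?powR_ge0. Qed.

Lemma measurable_truncated_power : measurable_fun [set: R] tp.
Proof.
by apply: measurable_funM; [exact: measurable_powR|exact: measurable_indic].
Qed.

Lemma integral_truncated_power_tail (x : R) :
  (\int[mu]_(r in `[x, +oo[) (tp r)%:E =
   (Num.max x tau `^ (- alpha) / alpha)%:E)%E.
Proof.
rewrite -integral_powR_tail; last by rewrite lt_max tau_gt0 orbT.
have -> : `[Num.max x tau, +oo[%classic = `[x, +oo[ `&` `[tau, +oo[ :> set R.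
  by apply/seteqP; split=> r /=; rewrite !in_itv/= !andbT ge_max => /andP.
rewrite integral_mkcondr; apply: eq_integral => r _.
by rewrite /truncated_power patchE indicE; case: ifPn; rewrite (mulr1, mulr0).
Qed.

Lemma integral_truncated_power :
  (\int[mu]_r (tp r)%:E = (tau `^ (- alpha) / alpha)%:E)%E.
Proof.
rewrite -integral_powR_tail// [RHS]integral_mkcond; apply: eq_integral => r _.
by rewrite /truncated_power patchE indicE; case: ifPn; rewrite (mulr1, mulr0).
Qed.

Lemma integrable_truncated_power : mu.-integrable [set: R] (EFin \o tp).
Proof.
apply/integrableP; split.
  by apply/measurable_EFinP; exact: measurable_truncated_power.
under eq_integral do rewrite /= ger0_norm ?truncated_power_ge0//.
by rewrite integral_truncated_power ltry.
Qed.

Lemma Rintegral_truncated_power : \int[mu]_r tp r = tau `^ (- alpha) / alpha.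
Proof. by rewrite /Rintegral integral_truncated_power. Qed.

Lemma Rintegral_truncated_power_gt0 : 0 < \int[mu]_r tp r.
Proof. by rewrite Rintegral_truncated_power divr_gt0 ?powR_gt0. Qed.

Lemma is_pdf_proposal_density : is_pdf (proposal_density alpha tau).
Proof.
apply: is_pdf_normalized.
- exact: measurable_truncated_power.
- exact: truncated_power_ge0.
- exact: Rintegral_truncated_power_gt0.
Qed.

(** Closed rays determine a finite measure, so this survival function is the only fact about the
    proposal law that the quantile construction has to match. The maximum accounts for rays starting
    below tau. *)
Lemma law_of_proposal_tail (x : R) :
  law_of_density (proposal_density alpha tau) `[x, +oo[ =
  ((Num.max x tau / tau) `^ (- alpha))%:E.
Proof.
rewrite /proposal_density law_of_normalized//.
- rewrite /law_of_density integral_truncated_power_tail integral_truncated_power.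
  have m0 : 0 < Num.max x tau by rewrite lt_max tau_gt0 orbT.
  rewrite inver gt_eqF ?divr_gt0 ?powR_gt0// -EFinM; congr EFin.
  rewrite powRM ?invr_ge0 ?ltW// -(powR_inv1 (ltW tau_gt0)) -powRrM mulN1r opprK.
  rewrite (powRN tau); field.
  by rewrite !gt_eqF ?powR_gt0.
- exact: measurable_truncated_power.
- exact: truncated_power_ge0.
- exact: Rintegral_truncated_power_gt0.
Qed.

End power_law.

(** * The target density and its relation to the accepted density *)

Section target.
Context {R : realType}.
Notation mu := (@lebesgue_measure R).

(** If g had integral 0 it would vanish almost everywhere, hence so would f, against its positive
    integral. It yields first C > 0, with f Gaussian, and then a positive normalizing constant, with
    f the truncated power. *)
Lemma Rintegral_gt0_support (f g : R -> R) :
  measurable_fun [set: R] f -> (forall x, 0 <= f x) ->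
  (0 < \int[mu]_x (f x)%:E)%E ->
  mu.-integrable [set: R] (EFin \o g) -> (forall x, 0 <= g x) ->
  (forall x, g x = 0 -> f x = 0) -> 0 < \int[mu]_x g x.
Proof.
move=> mf f0 If ig g0 gf; rewrite lt_neqAle Rintegral_ge0// andbT eq_sym.
apply/eqP => Ig; move: If; rewrite lt_neqAle => /andP[+ _].
rewrite eq_sym => /negP; apply; apply/eqP.
have mEf : measurable_fun [set: R] (EFin \o f) by exact/measurable_EFinP.
under eq_integral do rewrite -[(f _)%:E]gee0_abs ?lee_fin//.
apply/(ae_eq_integral_abs mu measurableT mEf).
have Ig0 : (\int[mu]_x `|(EFin \o g) x| = 0)%E.
  under eq_integral do rewrite gee0_abs ?lee_fin//.
  rewrite -(fineK (integrable_fin_num measurableT ig)).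
  by rewrite -/(Rintegral _ _ _) Ig.
have /(ae_eq_integral_abs mu measurableT (measurable_int _ ig)) := Ig0.
by apply: filterS => x /(_ I) /= [gx0] _; rewrite (gf _ gx0).
Qed.

Variables (alpha tau sigma A B X : R).
Hypotheses (alpha_gt0 : 0 < alpha) (tau_gt0 : 0 < tau) (A_lt0 : A < 0).

Lemma tilt_C_gt0 r : 0 < tilt_C sigma A B X r.
Proof.
apply: (@Rintegral_gt0_support (normal_pdf 0 (r * sigma))).
- exact: measurable_normal_pdf.
- by move=> y; exact: normal_pdf_ge0.
- by rewrite integral_normal_pdf.
- exact: integrable_tilt_integrand.
- exact: tilt_integrand_ge0.
- by move=> y /eqP; rewrite mulf_eq0 gt_eqF ?expR_gt0//= => /eqP.
Qed.

Lemma acceptance_probability_itv r :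
  0 <= acceptance_probability sigma A B X r <= 1.
Proof.
rewrite /acceptance_probability divr_ge0 ?tilt_C_ge0 ?(ltW (tilt_M_gt0 _ _ _))//=.
by rewrite ler_pdivrMr ?tilt_M_gt0// mul1r tilt_C_le.
Qed.

Lemma measurable_acceptance_probability :
  measurable_fun [set: R] (acceptance_probability sigma A B X).
Proof. by apply: measurable_funM => //; exact: measurable_tilt_C. Qed.

Lemma measurable_tilted_power : measurable_fun [set: R]
  (fun r => tilt_C sigma A B X r * truncated_power alpha tau r).
Proof.
apply: measurable_funM; first exact: measurable_tilt_C.
exact: measurable_truncated_power.
Qed.

Lemma integrable_tilted_power : mu.-integrable [set: R]
  (EFin \o (fun r => tilt_C sigma A B X r * truncated_power alpha tau r)).
Proof.
apply: (le_integrable measurableT _ _ (integrableZl measurableT (tilt_M A B X)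
  (integrable_truncated_power alpha_gt0 tau_gt0))).
  by apply/measurable_EFinP; exact: measurable_tilted_power.
move=> r _ /=; rewrite lee_fin !normrM ler_wpM2r//.
by rewrite !ger0_norm ?tilt_C_le ?tilt_C_ge0// ltW// tilt_M_gt0.
Qed.

Lemma Rintegral_tilted_power_gt0 :
  0 < \int[mu]_r (tilt_C sigma A B X r * truncated_power alpha tau r).
Proof.
apply: (@Rintegral_gt0_support (truncated_power alpha tau)).
- exact: measurable_truncated_power.
- exact: truncated_power_ge0.
- by rewrite integral_truncated_power// lte_fin divr_gt0 ?powR_gt0.
- exact: integrable_tilted_power.
- by move=> r; rewrite mulr_ge0 ?tilt_C_ge0 ?truncated_power_ge0.
- by move=> r /eqP; rewrite mulf_eq0 gt_eqF ?tilt_C_gt0//= => /eqP.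
Qed.

Lemma is_pdf_tilted_density : is_pdf (tilted_density alpha tau sigma A B X).
Proof.
apply: is_pdf_normalized.
- exact: measurable_tilted_power.
- by move=> r; rewrite mulr_ge0 ?tilt_C_ge0 ?truncated_power_ge0.
- exact: Rintegral_tilted_power_gt0.
Qed.

Let q := proposal_density alpha tau.
Let a := acceptance_probability sigma A B X.

(** The constant ratio between the accepted density a q and the unnormalized target; it cancels
    under [normalized]. *)
Let k := (tilt_M A B X * \int[mu]_r truncated_power alpha tau r)^-1.

Let k_gt0 : 0 < k.
Proof.
by rewrite invr_gt0 mulr_gt0 ?tilt_M_gt0// Rintegral_truncated_power_gt0.
Qed.

Let accepted_densityE : (fun r => a r * q r) =
  (fun r => k * (tilt_C sigma A B X r * truncated_power alpha tau r)).
Proof.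
apply/funext => r; rewrite /a /q /acceptance_probability /proposal_density.
by rewrite /normalized /k invfM mulrACA mulrC.
Qed.

Lemma tilted_densityE :
  tilted_density alpha tau sigma A B X = normalized (fun r => a r * q r).
Proof.
by rewrite accepted_densityE normalized_scale ?gt_eqF//; exact: integrable_tilted_power.
Qed.

Lemma Rintegral_accepted_density_gt0 : 0 < \int[mu]_r (a r * q r).
Proof.
rewrite accepted_densityE RintegralZl//; last exact: integrable_tilted_power.
by rewrite mulr_gt0// Rintegral_tilted_power_gt0.
Qed.

End target.

(** * The law of the proposal in a single accepted round *)

Section one_round.
Context {R : realType}.
Notation mu := (@lebesgue_measure R).
Variables q a : R -> R.
Hypotheses (pdfq : is_pdf q) (ma : measurable_fun [set: R] a).
Hypothesis a01 : forall r, 0 <= a r <= 1.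

Lemma integral_law_of_density (nu : probability (measurableTypeR R) R) (E : set R) :
  (forall E, measurable E -> nu E = law_of_density q E) -> measurable E ->
  (\int[nu]_(r in E) (a r)%:E = \int[mu]_(r in E) (a r * q r)%:E)%E.
Proof.
move=> nuE mE; have [mq q0 q1] := pdfq.
have mEq : measurable_fun [set: R] (EFin \o q) by exact/measurable_EFinP.
have mEa : measurable_fun [set: R] (EFin \o a) by exact/measurable_EFinP.
have iq : mu.-integrable [set: R] (EFin \o q).
  apply/integrableP; split => //.
  by under eq_integral do rewrite gee0_abs ?lee_fin//; rewrite q1 ltry.
(* [q] is the Radon-Nikodym derivative of [nu]. *)
have dom : nu `<< mu.
  apply/null_content_dominatesP => D mD D0.
  rewrite nuE// /law_of_density null_set_integral//.
  exact: measurable_funTS.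
(* Both functions integrate to [nu D] over every measurable subset D of E, which forces equality
   almost everywhere on E. *)
have RNq : ae_eq mu E (Radon_Nikodym (charge_of_finite_measure nu) mu) (EFin \o q).
  apply: integral_ae_eq => //.
  - by apply: (integrableS measurableT) => //; exact: Radon_Nikodym_integrable.
  - exact: measurable_funTS.
  - by move=> D _ mD; rewrite -Radon_Nikodym_integral//= nuE.
rewrite -(Radon_Nikodym_change_of_variables dom)//; last first.
  have i1 := finite_measure_integrable_cst nu (1 : R) mE.
  apply: (le_integrable _ _ _ i1) => //; first exact: measurable_funTS.
  move=> r _ /=.
  by rewrite lee_fin normr1; have /andP[? ?] := a01 r; rewrite ger0_norm.
apply: ae_eq_integral => //.
- by apply: measurable_funTS; apply: emeasurable_funM.
- by apply: measurable_funTS; apply/measurable_EFinP; exact: measurable_funM.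
- by move: RNq; apply: filterS => r /= + Er => /(_ Er) ->; rewrite EFinM.
Qed.

Lemma integral_distribution_density d (T : measurableType d) (P : probability T R)
    (rho : {RV P >-> R}) (E : set R) :
  (forall E, measurable E -> distribution P rho E = law_of_density q E) ->
  measurable E ->
  (\int[distribution P rho]_(r in E) (a r)%:E)%E =
  law_of_density (fun r => a r * q r) E.
Proof.
move=> lrho mE.
(* [R] and [measurableTypeR R] have the same measurable sets but carry structures
   that are not convertible, so the law of [rho] is transported to the latter. *)
pose f : T -> measurableTypeR R := rho.
have mf : measurable_fun [set: T] f by exact: (measurable_funPT rho).
pose rho' : {RV P >-> measurableTypeR R} :=
  HB.pack f (isMeasurableFun.Build _ _ _ _ _ mf).
have lrho' D : measurable D -> distribution P rho' D = law_of_density q D.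
  by move=> mD; exact: lrho.
rewrite -[RHS](integral_law_of_density lrho' mE).
have a0 r : (0 <= (a r)%:E)%E by rewrite lee_fin; have /andP[] := a01 r.
rewrite /distribution !ge0_integral_pushforward//.
- by apply: measurable_funTS; apply/measurable_EFinP.
- by apply: measurable_funTS; apply/measurable_EFinP.
Qed.

Lemma round_law d (T : measurableType d) (P : probability T R)
    (rho : {RV P >-> R}) (acc : {RV P >-> bool}) (E : set R) :
  proposal_round q a rho acc -> measurable E ->
  P (rho @^-1` E `&` acc @^-1` [set true]) = law_of_density (fun r => a r * q r) E.
Proof. by move=> [lrho lacc] mE; rewrite lacc// integral_distribution_density. Qed.

Hypothesis aq_gt0 : 0 < \int[mu]_r (a r * q r).

Let maq : measurable_fun [set: R] (fun r => a r * q r).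
Proof. by have [mq _ _] := pdfq; exact: measurable_funM. Qed.

Let aq_ge0 r : 0 <= a r * q r.
Proof. by have [_ q0 _] := pdfq; have /andP[a0 _] := a01 r; rewrite mulr_ge0. Qed.

Lemma round_accept d (T : measurableType d) (P : probability T R)
    (rho : {RV P >-> R}) (acc : {RV P >-> bool}) :
  proposal_round q a rho acc ->
  P (acc @^-1` [set true]) = (\int[mu]_r (a r * q r)%:E)%E.
Proof. by move=> /round_law/(_ measurableT); rewrite preimage_setT setTI. Qed.

Lemma round_accept_gt0 d (T : measurableType d) (P : probability T R)
    (rho : {RV P >-> R}) (acc : {RV P >-> bool}) :
  proposal_round q a rho acc -> (0 < P (acc @^-1` [set true]))%E.
Proof.
move=> /round_accept ->; move: aq_gt0; rewrite /Rintegral.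
by case: (integral _ _ _) => //=; rewrite ltxx.
Qed.

Lemma round_conditional_law d (T : measurableType d) (P : probability T R)
    (rho : {RV P >-> R}) (acc : {RV P >-> bool}) (E : set R) :
  proposal_round q a rho acc -> measurable E ->
  conditional_probability P (rho @^-1` E) (acc @^-1` [set true]) =
  law_of_density (normalized (fun r => a r * q r)) E.
Proof.
move=> rnd mE; rewrite /conditional_probability (round_law rnd mE).
by rewrite (round_accept rnd) law_of_normalized.
Qed.

End one_round.

(** * Independent rounds: the law of the first accepted proposal *)

Section sampler.
Context {R : realType}.
Notation mu := (@lebesgue_measure R).
Variables q a : R -> R.
Hypotheses (pdfq : is_pdf q) (ma : measurable_fun [set: R] a).
Hypothesis a01 : forall r, 0 <= a r <= 1.
Hypothesis aq_gt0 : 0 < \int[mu]_r (a r * q r).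
Context d (T : measurableType d) (P : probability T R).
Variables (rho : nat -> {RV P >-> R}) (acc : nat -> {RV P >-> bool}).
Hypothesis sampler : rejection_sampler q a rho acc.

Let law E := law_of_density (fun r => a r * q r) E.
Let p := \int[mu]_r (a r * q r).

Let round_lawE n E : measurable E ->
  P (rho n @^-1` E `&` acc n @^-1` [set true]) = law E.
Proof. by move=> mE; have [/(_ n) /round_law ->] := sampler. Qed.

Let accept_probE n : P (acc n @^-1` [set true]) = p%:E.
Proof.
have [/(_ n) rnd _] := sampler.
(* A probability is finite, so the extended integral of a q equals its real version [p]. *)
have fP : P (acc n @^-1` [set true]) \is a fin_num.
  by apply: fin_num_measure; exact: measurable_funPTI.
by rewrite -(fineK fP) (round_accept pdfq ma a01 rnd).
Qed.

Let lawT : law [set: R] = p%:E.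
Proof. by rewrite -(round_lawE 0)// preimage_setT setTI accept_probE. Qed.

Let law_fin E : measurable E -> law E \is a fin_num.
Proof.
move=> mE; rewrite -(round_lawE 0)// fin_num_measure//.
by apply: measurableI; exact: measurable_funPTI.
Qed.

Let reject_probE n : P (acc n @^-1` [set false]) = (1 - p)%:E.
Proof.
have -> : acc n @^-1` [set false] = ~` (acc n @^-1` [set true]).
  by apply/seteqP; split => w /=; case: (acc n w).
by rewrite probability_setC ?accept_probE//; exact: measurable_funPTI.
Qed.

Definition first_accepted_in (n : nat) (E : set R) : set T :=
  [set w | [/\ forall i, (i < n)%N -> acc i w = false, acc n w = true & E (rho n w)]].

(** A finite intersection of events, each concerning one round, is the form to which mutual
    independence applies. *)
Let first_accepted_inE n E : first_accepted_in n E =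
  \bigcap_(i in [set` iota 0 n.+1]) ((fun w => (rho i w, acc i w)) @^-1`
    (if (i < n)%N then [set: R] `*` [set false] else E `*` [set true])).
Proof.
have io i : ([set` iota 0 n.+1] i) = (i <= n)%N :> Prop.
  by rewrite /mkset mem_iota add0n.
apply/seteqP; split => [w [rej ac Ew] i|w H].
  rewrite io => lein; rewrite /preimage/=.
  case: ltnP => [lin|]; first by split => //=; exact: rej.
  by move=> leni; have -> : i = n by apply/eqP; rewrite eqn_leq lein.
have /(_ n) := H; rewrite io leqnn ltnn /= => /(_ isT)[/= Ew acn].
split => // i lin; have /(_ i) := H.
by rewrite io (ltnW lin) lin => /(_ isT)[].
Qed.

Let measurable_first_accepted_in n E : measurable E ->
  measurable (first_accepted_in n E).
Proof.
move=> mE; rewrite first_accepted_inE; apply: bigcap_measurable => //.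
  by exists 0%N; rewrite /mkset mem_iota.
move=> i _; rewrite -[X in measurable X]setTI.
have mZ : measurable_fun [set: T] (fun w => (rho i w, acc i w)).
  exact: measurable_fun_pair.
by apply: mZ => //; case: ifP => _; exact: measurableX.
Qed.

Let first_accepted_in_prob n E : measurable E ->
  P (first_accepted_in n E) = (((1 - p) ^+ n)%:E * law E)%E.
Proof.
move=> mE; have [_ ind] := sampler.
rewrite first_accepted_inE ind//; [|exact: iota_uniq|]; last first.
  by move=> i; case: ifP => _; exact: measurableX.
(* Round n is split off: it contributes [law E], and each of the n earlier rounds contributes the
   rejection probability 1 - p. *)
rewrite -{1}addn1 iotaD big_cat/= big_seq1 add0n ltnn.
rewrite -(round_lawE n)//; congr (_ * _)%E.
transitivity (\prod_(i <- iota 0 n) (1 - p)%:E)%E.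
  apply: eq_big_seq => i; rewrite mem_iota add0n => /= ->.
  rewrite -(reject_probE i); congr (P _).
  by apply/seteqP; split => w /= => [[]|].
rewrite big_const_seq count_predT size_iota.
by elim: n => //= n ->; rewrite exprS EFinM.
Qed.

Let trivIset_first_accepted_in E : trivIset [set: nat] (first_accepted_in ^~ E).
Proof.
apply/trivIsetP => i j _ _; wlog ij : i j / (i < j)%N => [H|_].
  rewrite neq_ltn => /orP[] ?; [|rewrite setIC]; apply: H => //.
    by rewrite ltn_eqF.
  by rewrite ltn_eqF.
apply/seteqP; split => // w [[_ ai _] [rej _ _]].
by have := rej _ ij; rewrite ai.
Qed.

Let p_gt0 : 0 < p := aq_gt0.

Let p_le1 : p <= 1.
Proof.
rewrite -lee_fin -(accept_probE 0) probability_le1//.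
exact: measurable_funPTI.
Qed.

Let measurable_output_in E : measurable E ->
  measurable (\bigcup_n first_accepted_in n E).
Proof.
move=> mE; apply: bigcupT_measurable => n.
exact: measurable_first_accepted_in.
Qed.

(** The events for different n are disjoint, so countable additivity gives a geometric series of
    ratio 1 - p, which lies in [0, 1[ because 0 < p <= 1. *)
Let output_in_prob E : measurable E ->
  P (\bigcup_n first_accepted_in n E) = (law E / p%:E)%E.
Proof.
move=> mE.
have sP : semi_sigma_additive P by exact: measure_semi_sigma_additive.
have := sP _ (fun n => measurable_first_accepted_in n mE)
  (@trivIset_first_accepted_in E) (measurable_output_in mE).
move=> /cvg_lim <-//; apply/cvg_lim => //.
rewrite -(fineK (law_fin mE)) inver gt_eqF// -EFinM.
have -> : (fun n => \sum_(0 <= i < n) P (first_accepted_in i E))%E =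
    EFin \o series (geometric (fine (law E)) (1 - p)).
  apply/funext => n; rewrite /= /series/= -sumEFin; apply: eq_bigr => i _.
  by rewrite first_accepted_in_prob// -{1}(fineK (law_fin mE)) -EFinM mulrC.
apply: cvg_EFin; first exact: nearW.
rewrite -[X in _ / X](_ : 1 - (1 - p) = p); last by rewrite subKr.
apply: cvg_geometric_series.
by rewrite ger0_norm ?subr_ge0// ltrBlDr ltrDl.
Qed.

Let accepts_eventually :
  [set w | exists n, acc n w] = \bigcup_n first_accepted_in n [set: R].
Proof.
apply/seteqP; split => w /= => [ex_acc|[n _ [_ acn _]]]; last by exists n.
have acm := ex_minnP ex_acc; case: acm => m acm mmin; exists m => //; split => //.
by move=> i im; apply/negbTE/negP => aci; have := mmin _ aci; rewrite leqNgt im.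
Qed.

Lemma sampler_accepts : P [set w | exists n, acc n w] = 1%E.
Proof.
rewrite accepts_eventually output_in_prob// lawT divee//.
by rewrite eqe gt_eqF.
Qed.

(** The second piece is where no round accepts: the output is then the default 0, which counts
    exactly when 0 lies in E. *)
Let preimage_output E : sampler_output rho acc @^-1` E =
  (\bigcup_n first_accepted_in n E) `|`
  (~` [set w | exists n, acc n w] `&` [set w | E 0]).
Proof.
apply/seteqP; split => w.
- rewrite /preimage /= /sampler_output; case: pselect => [ex_acc|nex] Ew; last by right.
  left; move: Ew; case: ex_minnP => m acm mmin Ew; exists m => //; split => //.
  by move=> i im; apply/negbTE/negP => aci; have := mmin _ aci; rewrite leqNgt im.
- rewrite /preimage /= /sampler_output; case: pselect => [ex_acc|nex].
    case=> [[n _ [rej acn Ew]]|[]//]; case: ex_minnP => m acm mmin.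
    have -> : m = n; last by [].
    apply/eqP; rewrite eqn_leq mmin//= leqNgt; apply/negP => mn.
    by rewrite (rej _ mn) in acm.
  by case=> [[n _ [_ acn _]]|[]//]; exfalso; apply: nex; exists n.
Qed.

Let measurable_never : measurable (~` [set w | exists n, acc n w]).
Proof.
apply: measurableC; rewrite accepts_eventually.
exact: measurable_output_in.
Qed.

Let measurable_never_in (E : set R) :
  measurable (~` [set w | exists n, acc n w] `&` [set w | E 0]).
Proof.
apply: measurableI; first exact: measurable_never.
case: (pselect (E 0)) => E0.
  by have -> : [set _ : T | E 0] = setT by apply/seteqP; split.
by have -> : [set _ : T | E 0] = set0 by apply/seteqP; split.
Qed.

Let measurable_preimage_output E : measurable E ->
  measurable (sampler_output rho acc @^-1` E).
Proof.
move=> mE; rewrite preimage_output; apply: measurableU.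
  exact: measurable_output_in.
exact: measurable_never_in.
Qed.

Lemma measurable_sampler_output : measurable_fun [set: T] (sampler_output rho acc).
Proof. by move=> _ E mE; rewrite setTI; exact: measurable_preimage_output. Qed.

Lemma sampler_output_law E : measurable E ->
  P (sampler_output rho acc @^-1` E) =
  law_of_density (normalized (fun r => a r * q r)) E.
Proof.
move=> mE; have [mq q0 _] := pdfq.
rewrite law_of_normalized//; last 2 first.
- exact: measurable_funM.
- by move=> r; have /andP[a0 _] := a01 r; rewrite mulr_ge0.
have -> : (\int[mu]_r (a r * q r)%:E = p%:E)%E by exact: lawT.
rewrite -output_in_prob// preimage_output; apply/eqP; rewrite eq_le.
have mout := measurable_output_in mE.
have := measurable_preimage_output mE; rewrite preimage_output => mN.
apply/andP; split; last by apply: le_measure; rewrite ?inE.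
(* The default value only matters on a null event, so it adds nothing to the upper bound. *)
have never0 : P (~` [set w | exists n, acc n w]) = 0%E.
  rewrite probability_setC ?sampler_accepts ?subee//.
  by rewrite accepts_eventually; exact: measurable_output_in.
apply: le_trans (measureU2 P mout (measurable_never_in E)) _.
rewrite -[leRHS]adde0; apply: leeD2l; rewrite -[leRHS]never0.
by apply: le_measure; rewrite ?inE//; exact: subIsetl.
Qed.

End sampler.

(** * Independent copies obtained by iterating a map *)

Section iterated_independence.
Local Open Scope ereal_scope.
Context {R : realType} d d' (T : measurableType d) (T' : measurableType d').
Variables (P : probability T R) (f : T -> T') (g : T -> T).
Hypotheses (mf : measurable_fun [set: T] f) (mg : measurable_fun [set: T] g).
(** This combines two facts: f is independent of g, and, taking A to be the whole space, g preserves
    P. It is applied to the first binary digit with the doubling map, and to one sampling round with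
    the odd coins. *)
Hypothesis fg_indep : forall A B, measurable A -> measurable B ->
  P (f @^-1` A `&` g @^-1` B) = P (f @^-1` A) * P B.

Lemma measurable_iter n : measurable_fun [set: T] (iter n g).
Proof. by elim: n => [|n IHn]; [exact: measurable_id|exact: measurableT_comp]. Qed.

Let mpre n A : measurable A -> measurable ((fun w => f (iter n g w)) @^-1` A).
Proof.
move=> mA; rewrite -[X in measurable X]setTI.
by apply: (measurableT_comp mf (measurable_iter n)).
Qed.

Let measure_preserving B : measurable B -> P (g @^-1` B) = P B.
Proof.
move=> mB; have := fg_indep measurableT mB.
by rewrite preimage_setT setTI probability_setT mul1e.
Qed.

Lemma iter_preimage_prob n A : measurable A ->
  P ((fun w => f (iter n g w)) @^-1` A) = P (f @^-1` A).
Proof.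
move=> mA; elim: n => // n <-.
rewrite -[RHS]measure_preserving; last exact: mpre.
by congr (P _); apply/funext => w; rewrite /preimage/= -iterSr.
Qed.

(** Induction on N: the events of index at least 1 form the preimage under g of the same
    intersection with shifted indices, so [fg_indep] splits off the event of index 0. *)
Let initial_indep N (D : nat -> set T') : (forall i, measurable (D i)) ->
  P (\bigcap_(i < N) ((fun w => f (iter i g w)) @^-1` D i)) =
  \prod_(i < N) P (f @^-1` D i).
Proof.
elim: N D => [|N IHN] D mD.
  by rewrite bigcap_mkord !big_ord0 probability_setT.
rewrite big_ord_recl -[X in _ * X](IHN (fun i => D i.+1))//.
rewrite -fg_indep//; last by apply: bigcap_measurableType => i _; exact: mpre.
congr (P _); apply/seteqP; split => w.
- move=> H; split; first exact: (H 0%N).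
  by move=> i /= iN; have := H i.+1; rewrite /preimage/= -iterSr; exact.
- move=> [D0 H] [|i] //= iN; have := H i iN.
  by rewrite /preimage/= -iterSr.
Qed.

Lemma mutually_independent_iter : mutually_independent P (fun n w => f (iter n g w)).
Proof.
move=> s D us mD.
pose N := (\max_(i <- s) i).+1.
have sN i : i \in s -> (i < N)%N.
  by move=> si; rewrite ltnS; apply: leq_bigmax_seq.
pose D' i := if i \in s then D i else setT.
have mD' i : measurable (D' i) by rewrite /D'; case: ifP.
transitivity (P (\bigcap_(i < N) ((fun w => f (iter i g w)) @^-1` D' i))).
  congr (P _); apply/seteqP; split => w H i /=.
    by move=> _; rewrite /D'; case: ifP => [si|_ //]; exact: H.
  by move=> si; have := H i (sN _ si); rewrite /D' /preimage/= si.
rewrite initial_indep// -(big_mkord xpredT (fun i => P (f @^-1` D' i))).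
transitivity (\prod_(i <- index_iota 0 N | i \in s) P (f @^-1` D i)).
  rewrite [RHS]big_mkcond; apply: eq_bigr => i _; rewrite /D'.
  by case: ifP => //; rewrite preimage_setT probability_setT.
rewrite -big_filter; transitivity (\prod_(i <- s) P (f @^-1` D i)).
  apply: perm_big; apply: uniq_perm => //; first by rewrite filter_uniq// iota_uniq.
  by move=> i; rewrite mem_filter mem_index_iota /= andb_idr// => /sN.
by apply: eq_bigr => i _; rewrite iter_preimage_prob.
Qed.

End iterated_independence.

(** * Independence checked on generating pi-systems *)

Section independence_on_generators.
Local Open Scope ereal_scope.
Context {R : realType} {d d1 d2 : measure_display} (T : measurableType d).
Context (T1 : measurableType d1) (T2 : measurableType d2).
Variables (P : probability T R) (P1 : probability T1 R) (P2 : probability T2 R).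
Variables (G1 : set (set T1)) (G2 : set (set T2)).
Hypotheses (mG1 : measurable = <<s G1 >>) (mG2 : measurable = <<s G2 >>).
Hypotheses (G1I : setI_closed G1) (G2I : setI_closed G2).
Hypotheses (G1T : G1 [set: T1]) (G2T : G2 [set: T2]).
Variables (f : T -> T1) (g : T -> T2).
Hypotheses (mf : measurable_fun [set: T] f) (mg : measurable_fun [set: T] g).
Hypothesis fgG : forall A B, G1 A -> G2 B ->
  P (f @^-1` A `&` g @^-1` B) = P1 A * P2 B.

Let mfpre A : measurable A -> measurable (f @^-1` A).
Proof. by move=> mA; rewrite -[X in measurable X]setTI; exact: mf. Qed.

Let mgpre B : measurable B -> measurable (g @^-1` B).
Proof. by move=> mB; rewrite -[X in measurable X]setTI; exact: mg. Qed.

(** For fixed A in the first generator, both sides are finite measures in B agreeing on a generating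
    pi-system. [independent_of_generators] repeats the argument in A with B fixed. *)
Let half_indep A B : G1 A -> measurable B ->
  P (f @^-1` A `&` g @^-1` B) = P1 A * P2 B.
Proof.
move=> GA mB.
have mA : measurable A by rewrite mG1; exact: sub_sigma_algebra.
pose m1 := pushforward (mrestr P (mfpre mA)) g.
(* [mscale] takes a nonnegative real, hence the [fine] part of a finite probability. *)
pose k : {nonneg R} := NngNum (fine_ge0 (measure_ge0 P1 A)).
pose m2 := mscale k P2.
have m2E C : m2 C = P1 A * P2 C.
  by rewrite /m2 /mscale/= fineK// fin_num_measure.
rewrite -m2E setIC.
apply: (@measure_unique _ _ _ G2 (fun=> setT) mG2 G2I _ _ m1 m2) => //.
- by rewrite bigcup_const.
- by move=> C GC; rewrite [RHS]m2E -fgG// setIC.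
- move=> _; apply: le_lt_trans (ltry 1).
  rewrite /m1/= /pushforward/= /mrestr; apply: probability_le1.
  exact: measurableI (mgpre measurableT) (mfpre mA).
Qed.

Lemma independent_of_generators A B : measurable A -> measurable B ->
  P (f @^-1` A `&` g @^-1` B) = P1 A * P2 B.
Proof.
move=> mA mB.
pose m1 := pushforward (mrestr P (mgpre mB)) f.
pose k : {nonneg R} := NngNum (fine_ge0 (measure_ge0 P2 B)).
pose m2 := mscale k P1.
have m2E C : m2 C = P1 C * P2 B.
  by rewrite /m2 /mscale/= fineK ?fin_num_measure// muleC.
rewrite -m2E.
apply: (@measure_unique _ _ _ G1 (fun=> setT) mG1 G1I _ _ m1 m2) => //.
- by rewrite bigcup_const.
- by move=> C GC; rewrite [RHS]m2E -half_indep.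
- move=> _; apply: le_lt_trans (ltry 1).
  rewrite /m1/= /pushforward/= /mrestr; apply: probability_le1.
  exact: measurableI (mfpre measurableT) (mgpre mB).
Qed.

End independence_on_generators.

(** * Measures determined by closed rays *)

Section closed_rays.
Context {R : realType}.
Notation TR := (measurableTypeR R).

(** Closed rays generate the Borel sets, are stable under intersection by taking the larger
    endpoint, and the rays from -k exhaust the line with finite measure. *)
Lemma eq_measure_closed_rays (m1 m2 : {measure set TR -> \bar R}) :
  (forall x : R, m1 `[x, +oo[%classic = m2 `[x, +oo[%classic) ->
  (forall x : R, m1 `[x, +oo[%classic < +oo)%E ->
  forall B, measurable B -> m1 B = m2 B.
Proof.
move=> m12 m1oo B mB.
apply: (@measure_unique _ R TR (@RGenCInfty.G R)
  (fun k => `[(- k%:R : R), +oo[%classic) _ _ _ _ m1 m2) => //.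
- exact: RGenCInfty.measurableE.
- move=> _ _ [x ->] [y ->]; exists (Num.max x y).
  by apply/seteqP; split => z /=; rewrite !in_itv/= !andbT ge_max => /andP.
- by move=> k; exists (- k%:R).
- apply/seteqP; split => // x _; exists (Num.bound `|x|) => //=.
  rewrite in_itv/= andbT lerNl; apply: le_trans (ler_norm _) _.
  by rewrite normrN ltW// archi_boundP.
- by move=> _ [x ->]; exact: m12.
Qed.

End closed_rays.

(** * The uniform law on ]0, 1] and the doubling map *)

Section fair_bits.
Context {R : realType}.
Notation TR := (measurableTypeR R).
Notation mu := (@lebesgue_measure R).

(* The point 0 is left out: there the power law quantile has a junk value, and
   the doubling map sends ]0, 1] to itself. *)
Definition unif01 : set TR -> \bar R := mrestr mu (measurable_itv `]0, 1]).

HB.instance Definition _ := Measure.on unif01.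

Let unif01_setT : unif01 [set: TR] = 1%E.
Proof.
by rewrite /unif01 /mrestr setTI [LHS]lebesgue_measure_itv/= lte_fin ltr01 oppr0 addr0.
Qed.

HB.instance Definition _ := Measure_isProbability.Build _ _ R unif01 unif01_setT.

Lemma unif01_itv0c (b : R) : 0 <= b <= 1 -> unif01 `]-oo, b] = b%:E.
Proof.
move=> /andP[b0 b1]; rewrite /unif01 /mrestr.
have -> : `]-oo, b]%classic `&` `]0, 1]%classic = `]0, b]%classic :> set R.
  apply/seteqP; split => y /=; rewrite !in_itv/=; first by move=> [-> /andP[->]].
  by move=> /andP[-> yb]; split => //=; exact: le_trans yb b1.
rewrite [LHS]lebesgue_measure_itv/= lte_fin oppr0 addr0.
by case: ltP => // b0'; congr EFin; apply/le_anti/andP.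
Qed.

(** The strict inequality gives dyadic points of ]0, 1] the expansion ending in ones, so that 1/2 is
    doubled to 1 and not to 0. *)
Definition first_bit (x : TR) : bool := 2^-1 < x.
Definition double_mod1 (x : TR) : TR := (x *+ 2 - (first_bit x)%:R : R).

Lemma measurable_first_bit : measurable_fun [set: TR] first_bit.
Proof. exact: measurable_fun_ltr. Qed.

Lemma measurable_double_mod1 : measurable_fun [set: TR] double_mod1.
Proof.
rewrite /double_mod1; apply: measurable_funB.
  by under eq_fun do rewrite -mulr_natr; exact: measurable_funM.
rewrite (_ : (fun x : TR => (first_bit x)%:R) =
  (fun x => if first_bit x then 1 else 0)); last by apply/funext => x; case: first_bit.
by apply: measurable_fun_ifT => //; exact: measurable_first_bit.
Qed.

Let mbit (S : set bool) : measurable (first_bit @^-1` S).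
Proof. by rewrite -[X in measurable X]setTI; exact: measurable_first_bit. Qed.

Let mdbl B : measurable B -> measurable (double_mod1 @^-1` B).
Proof.
move=> mB; rewrite -[X in measurable X]setTI.
exact: measurable_double_mod1.
Qed.

Let first_bit_itv b : first_bit @^-1` [set b] `&` `]0, 1]%classic =
  `](b%:R / 2 : R), ((b%:R + 1) / 2)]%classic.
Proof.
apply/seteqP; split => y /=; rewrite /first_bit !in_itv/=; case: b => /=.
- by move=> [h /andP[y0 y1]]; apply/andP; split; lra.
- by move=> [/negbT]; rewrite -leNgt => h /andP[y0 y1]; apply/andP; split; lra.
- by move=> /andP[h1 h2]; split; [|apply/andP; split]; lra.
- move=> /andP[h1 h2]; split; last by apply/andP; split; lra.
  by apply/negbTE; rewrite -leNgt; lra.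
Qed.

(** On the half of ]0, 1] where the digit is b, the doubling map is y -> 2y - b and stretches that
    half onto ]0, 1], which halves measures. Rays [x, +oo[ suffice, according to whether they
    contain, cut or miss ]0, 1]. *)
Lemma unif01_digit_double_mod1 b B : measurable B ->
  unif01 (first_bit @^-1` [set b] `&` double_mod1 @^-1` B) = ((2^-1)%:E * unif01 B)%E.
Proof.
move=> mB.
have mD := measurable_double_mod1.
pose m1 := pushforward (mrestr unif01 (mbit [set b])) double_mod1.
have half_ge0 : 0 <= 2^-1 :> R by [].
pose m2 := mscale (NngNum half_ge0) unif01.
rewrite -[RHS]/(m2 B) setIC.
apply: (@eq_measure_closed_rays R m1 m2) => //.
- move=> x.
  rewrite [RHS](_ : _ = (2^-1)%:E * unif01 `[x, +oo[%classic)%E//.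
  transitivity (mu ([set y | x <= y *+ 2 - b%:R] `&`
      `](b%:R / 2 : R), ((b%:R + 1) / 2)]%classic)).
    rewrite -first_bit_itv /m1/= /pushforward/= /mrestr/= /unif01 /mrestr setIA.
    congr (mu (_ `&` _)).
    apply/seteqP; split => y /=; rewrite /double_mod1 in_itv/= andbT.
      by move=> [+ <-].
    by move=> [h yb]; rewrite yb.
  rewrite /unif01 /mrestr.
  have [x0|x0] := leP x 0.
    have -> : [set y | x <= y *+ 2 - b%:R] `&`
        `](b%:R / 2 : R), ((b%:R + 1) / 2)]%classic =
        `](b%:R / 2 : R), ((b%:R + 1) / 2)]%classic.
      apply/seteqP; split => y /=; rewrite in_itv/=; first by case.
      by move=> /andP[h ->]; rewrite h; split => //; lra.
    have -> : `[x, +oo[%classic `&` `]0, 1]%classic = `]0, 1]%classic :> set R.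
      apply/seteqP; split => y /=; rewrite !in_itv/= ?andbT; first by case.
      by move=> /andP[y0 ->]; rewrite y0 (le_trans x0 (ltW y0)).
    rewrite (lebesgue_measure_itv `]_, _]).
    rewrite [X in (_ * X)%E](lebesgue_measure_itv `]_, _])/= !lte_fin ltr01.
    by rewrite ifT -?EFinB -?EFinM; [congr EFin|]; lra.
  have [x1|x1] := leP x 1.
    have -> : [set y | x <= y *+ 2 - b%:R] `&`
        `](b%:R / 2 : R), ((b%:R + 1) / 2)]%classic =
        `[(x + b%:R) / 2, ((b%:R + 1) / 2)]%classic.
      apply/seteqP; split => y /=; rewrite !in_itv/=.
        by move=> [h /andP[_ ->]]; rewrite andbT; lra.
      by move=> /andP[h ->]; rewrite andbT; split; lra.
    have -> : `[x, +oo[%classic `&` `]0, 1]%classic = `[x, 1]%classic :> set R.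
      apply/seteqP; split => y /=; rewrite !in_itv/= ?andbT.
        by move=> [-> /andP[]].
      by move=> /andP[xy ->]; rewrite xy (lt_le_trans x0 xy).
    rewrite (lebesgue_measure_itv `[_, _]).
    rewrite [X in (_ * X)%E](lebesgue_measure_itv `[_, _])/= !lte_fin.
    (* At x = 1 both intervals shrink to a point, the branch of the length formula with value 0. *)
    have [x1'|x1'] := ltP x 1; first by rewrite ifT -?EFinB -?EFinM; [congr EFin|]; lra.
    by rewrite ifF ?mule0//; apply/negbTE; rewrite -leNgt; lra.
  have -> : [set y | x <= y *+ 2 - b%:R] `&`
      `](b%:R / 2 : R), ((b%:R + 1) / 2)]%classic = set0.
    by apply/seteqP; split => y //=; rewrite in_itv/= => -[h /andP[_ h']]; lra.
  have -> : `[x, +oo[%classic `&` `]0, 1]%classic = set0 :> set R.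
    by apply/seteqP; split => y //=; rewrite !in_itv/= ?andbT => -[xy /andP[_ y1]]; lra.
  by rewrite !measure0 mule0.
- move=> x; apply: le_lt_trans (ltry 1); rewrite /m1/= /pushforward/= /mrestr.
  by apply: probability_le1; exact: measurableI (mdbl _) (mbit _).
Qed.

End fair_bits.

(** * Fair coin sequences and their even and odd halves *)

Section coin_space.
Context {R : realType}.
Notation TR := (measurableTypeR R).

(** The case of one digit is summed over the elements of S. Taking B to be everything identifies the
    resulting factor with the probability of S. *)
Lemma unif01_first_bit_double_mod1 (S : set bool) (B : set TR) : measurable B ->
  unif01 (first_bit @^-1` S `&` double_mod1 @^-1` B) =
  (unif01 (first_bit @^-1` S) * unif01 B)%E.
Proof.
pose h (b : bool) : \bar R := if `[< S b >] then (2^-1)%:E else 0%E.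
have mD B' : measurable B' -> measurable (double_mod1 @^-1` B' : set TR).
  by move=> mB'; rewrite -[X in measurable X]setTI; exact: measurable_double_mod1.
have mb (S' : set bool) : measurable (first_bit @^-1` S' : set TR).
  by rewrite -[X in measurable X]setTI; exact: measurable_first_bit.
have hE b B' : measurable B' ->
    unif01 (first_bit @^-1` (S `&` [set b]) `&` double_mod1 @^-1` B') =
    (h b * unif01 B')%E.
  move=> mB'; rewrite /h; case: asboolP => Sb.
    have -> : S `&` [set b] = [set b] by apply/seteqP; split => [c []//|c /= ->].
    exact: unif01_digit_double_mod1.
  have -> : S `&` [set b] = set0.
    by apply/seteqP; split => // c [Sc] /= cb; rewrite cb in Sc.
  by rewrite preimage_set0 set0I measure0 mul0e.
have hS B' : measurable B' ->
    unif01 (first_bit @^-1` S `&` double_mod1 @^-1` B') =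
    ((h true + h false) * unif01 B')%E.
  move=> mB'.
  rewrite ge0_muleDl -?hE//; last 2 first.
  - by rewrite /h; case: ifP.
  - by rewrite /h; case: ifP.
  rewrite -measureU.
  - congr (unif01 _); apply/seteqP; split => x.
      move=> [Sx Bx]; rewrite /preimage/= in Sx *.
      by case: (first_bit x) Sx => Sx; [left|right].
    by move=> [] [[]].
  - exact: measurableI (mb _) (mD _ mB').
  - exact: measurableI (mb _) (mD _ mB').
  - by apply/seteqP; split => // x [[[_ xt] _] [[_ xf] _]]; rewrite /= xt in xf.
move=> mB; rewrite hS//; congr (_ * _)%E.
by have := hS _ measurableT; rewrite preimage_setT setIT probability_setT mule1.
Qed.

(** Prescribing only heads makes an intersection of boxes the box of the concatenated lists;
    complements recover the events prescribing tails. *)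
Definition coin_box (s : seq nat) : set (nat -> bool) :=
  [set w | forall i, i \in s -> w i = true].

Definition coin_space := g_sigma_algebraType (range coin_box).

Lemma coin_boxI : setI_closed (range coin_box).
Proof.
move=> _ _ [s _ <-] [t _ <-]; exists (s ++ t) => //; apply/seteqP; split => w.
  by move=> H; split => i it; apply: H; rewrite mem_cat it ?orbT.
by move=> [Hs Ht] i; rewrite mem_cat => /orP[/Hs|/Ht].
Qed.

Lemma coin_boxT : range coin_box setT.
Proof. by exists [::] => //; apply/seteqP; split. Qed.

Lemma measurable_coin_box s : measurable (coin_box s : set coin_space).
Proof. by apply: sub_sigma_algebra; exists s. Qed.

Lemma measurable_to_coin_space d (T : measurableType d) (f : T -> coin_space) :
  (forall i, measurable [set w | f w i = true]) -> measurable_fun [set: T] f.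
Proof.
move=> mf.
have mE : @measurable _ coin_space = <<s range coin_box >> by [].
apply: (measurability _ mE).
move=> _ [_ [s _ <-] <-]; rewrite setTI.
have -> : f @^-1` coin_box s = \bigcap_(i in [set` s]) [set w | f w i = true] by [].
by apply: bigcap_measurableType => i _; exact: mf.
Qed.

Lemma measurable_coin i : measurable [set w : coin_space | w i = true].
Proof.
have -> : [set w : coin_space | w i = true] = coin_box [:: i].
  apply/seteqP; split => w /=; first by move=> wi j; rewrite inE => /eqP ->.
  by apply; rewrite inE.
exact: measurable_coin_box.
Qed.

Definition binary_digits (x : TR) : coin_space :=
  fun n => first_bit (iter n double_mod1 x).

Let mbit n : measurable_fun [set: TR] (fun x => first_bit (iter n (@double_mod1 R) x)).
Proof.
apply: measurableT_comp; first exact: measurable_first_bit.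
by apply: measurable_iter; exact: measurable_double_mod1.
Qed.

Lemma measurable_binary_digits : measurable_fun [set: TR] binary_digits.
Proof.
apply: measurable_to_coin_space => i; rewrite -[X in measurable X]setTI.
exact: (mbit i measurableT (Y := [set true])).
Qed.

Definition binary_digits_RV : {RV (@unif01 R) >-> coin_space} :=
  HB.pack binary_digits (isMeasurableFun.Build _ _ _ _ _ measurable_binary_digits).

Definition coin_prob : probability coin_space R :=
  distribution (@unif01 R) binary_digits_RV.

Lemma coin_probE A : coin_prob A = unif01 (binary_digits @^-1` A).
Proof. by []. Qed.

(** The digits are the first bits along the orbit of the doubling map, hence independent and
    fair. *)
Lemma coin_prob_box s : uniq s -> coin_prob (coin_box s) = (2^-1 ^+ size s)%:E.
Proof.
move=> us; rewrite coin_probE.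
have := @mutually_independent_iter R _ _ _ _ (@unif01 R) _ _
  (@measurable_first_bit R) (@measurable_double_mod1 R)
  (fun S B _ => @unif01_first_bit_double_mod1 S B) s (fun=> [set true]) us.
move=> /(_ (fun=> I)) H.
transitivity (\prod_(i <- s) (2^-1 : R)%:E)%E; last first.
  by rewrite big_const_seq count_predT; elim: (size s) => //= n ->; rewrite exprS EFinM.
rewrite -[LHS]/(unif01 (\bigcap_(i in [set` s])
  ((fun x => first_bit (iter i double_mod1 x)) @^-1` [set true]))).
rewrite [LHS]H; apply: eq_bigr => i _.
rewrite (@iter_preimage_prob R _ _ _ _ (@unif01 R) _ _
  (@measurable_first_bit R) (@measurable_double_mod1 R)
  (fun S B _ => @unif01_first_bit_double_mod1 S B))//.
have := @unif01_digit_double_mod1 R true setT measurableT.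
by rewrite preimage_setT setIT probability_setT mule1.
Qed.

(* Splitting a fair coin sequence into its even and odd terms yields two independent
   fair coin sequences, so iterating the odd half produces infinitely many. *)
Definition even_coins (w : coin_space) : coin_space := fun n => w n.*2.
Definition odd_coins (w : coin_space) : coin_space := fun n => w n.*2.+1.

Lemma measurable_even_coins : measurable_fun [set: coin_space] even_coins.
Proof. by apply: measurable_to_coin_space => i; exact: measurable_coin. Qed.

Lemma measurable_odd_coins : measurable_fun [set: coin_space] odd_coins.
Proof. by apply: measurable_to_coin_space => i; exact: measurable_coin. Qed.

Lemma even_odd_coins_indep A B : measurable A -> measurable B ->
  coin_prob (even_coins @^-1` A `&` odd_coins @^-1` B) = (coin_prob A * coin_prob B)%E.
Proof.
apply: (@independent_of_generators R _ _ _ coin_space coin_space coin_space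
  coin_prob coin_prob coin_prob (range coin_box) (range coin_box)) => //.
- exact: coin_boxI.
- exact: coin_boxI.
- exact: coin_boxT.
- exact: coin_boxT.
- exact: measurable_even_coins.
- exact: measurable_odd_coins.
move=> _ _ [s _ <-] [t _ <-].
(* The probability of a box counts list entries, so repetitions must go first. *)
have undupE u : coin_box u = coin_box (undup u).
  by apply/seteqP; split => w H i; have := H i; rewrite mem_undup.
rewrite (undupE s) (undupE t).
move: (undup s) (undup t) (undup_uniq s) (undup_uniq t) => {}s {}t us ut.
have -> : even_coins @^-1` coin_box s `&` odd_coins @^-1` coin_box t =
    coin_box (map double s ++ map (S \o double) t).
  apply/seteqP; split => w.
    move=> [ws wt] i; rewrite mem_cat => /orP[] /mapP[j js ->]; [exact: ws|exact: wt].
  move=> H; split => i it; apply: H; rewrite mem_cat; apply/orP.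
    by left; exact: map_f.
  by right; apply/mapP; exists i.
rewrite !coin_prob_box// ?size_cat ?size_map ?exprD//.
rewrite cat_uniq !map_inj_uniq//; last 2 first.
- by move=> i j /= [] /double_inj.
- exact: double_inj.
(* Parity keeps the two index lists disjoint, so the sizes add and the probabilities multiply. *)
rewrite us ut andbT/=; apply/hasPn => _ /mapP[j _ ->]; apply/negP => /mapP[i _ /= ij].
by have := congr1 odd ij; rewrite /= !odd_double.
Qed.

End coin_space.

(** * Recovering a uniform variable from its binary digits *)

Section coin_value.
Context {R : realType}.
Notation TR := (measurableTypeR R).

(* The upper limit makes measurability immediate; convergence is only needed, and
   only proved, along the binary digits of points of ]0, 1]. *)
Definition coin_value (w : coin_space) : R :=
  fine (limn_esup (fun n => (\sum_(k < n) (w k)%:R / 2 ^+ k.+1 : R)%:E)).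

Lemma measurable_coin_value : measurable_fun [set: coin_space] coin_value.
Proof.
apply: (measurableT_comp (@fine_measurable R setT measurableT)).
apply: measurable_fun_limn_esup => n; apply/measurable_EFinP.
apply: measurable_sum => k; apply: measurable_funM => //.
rewrite (_ : (fun w : coin_space => (w k)%:R) = (fun w => if w k then 1 else 0 : R));
  last by apply/funext => w; case: (w k).
apply: measurable_fun_ifT => //; apply: (measurable_fun_bool true).
by rewrite setTI; exact: measurable_coin.
Qed.

Lemma double_mod1_itv (y : R) : 0 < y <= 1 -> 0 < (double_mod1 y : R) <= 1.
Proof.
move=> /andP[y0 y1]; rewrite /double_mod1 /first_bit.
by case: (ltP 2^-1 y) => /= h; apply/andP; split; lra.
Qed.

Lemma coin_value_binary_digits (x : R) : 0 < x <= 1 -> coin_value (binary_digits x) = x.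
Proof.
move=> x01.
have D01 n : 0 < (iter n (@double_mod1 R) x : R) <= 1.
  elim: n => //= n; exact: double_mod1_itv.
(* The remainder after n digits is the n-th doubling iterate, a point of ]0, 1], scaled by
   2^(-n). *)
have SE n : \sum_(k < n) (binary_digits x k)%:R / 2 ^+ k.+1 =
    x - (iter n (@double_mod1 R) x : R) * 2^-1 ^+ n.
  elim: n => [|n IHn]; first by rewrite big_ord0 expr0 mulr1 subrr.
  rewrite big_ord_recr/= IHn /binary_digits [in RHS]/double_mod1.
  by rewrite !exprS !exprVn; field; rewrite expf_neq0.
rewrite /coin_value.
have cS : (fun n => \sum_(k < n) (binary_digits x k)%:R / 2 ^+ k.+1 : R) @ \oo --> x.
  have half1 : `|2^-1 : R| < 1 by rewrite ger0_norm//; lra.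
  have c0 : (fun n => (iter n (@double_mod1 R) x : R) * 2^-1 ^+ n) @ \oo --> (0 : R).
    apply: (@squeeze_cvgr _ _ _ R (fun=> 0) (fun n => 2^-1 ^+ n));
      [|exact: cvg_cst|exact: cvg_expr half1].
    apply: nearW => n; have /andP[y0 y1] := D01 n.
    by rewrite mulr_ge0 ?exprn_ge0 ?(ltW y0)//= ler_piMl// exprn_ge0.
  rewrite (_ : (fun n => _) = (fun n => x -
    (iter n (@double_mod1 R) x : R) * 2^-1 ^+ n));
    last by apply/funext => n; rewrite SE.
  have cx : ((fun=> x) : nat -> R) @ \oo --> x by exact: cvg_cst.
  have h : (fun n => x - (iter n (@double_mod1 R) x : R) * 2^-1 ^+ n) @ \oo --> x - 0.
    exact: (cvgB cx c0).
  by rewrite subr0 in h; exact: h.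
have cES : (fun n => (\sum_(k < n) (binary_digits x k)%:R / 2 ^+ k.+1 : R)%:E)
    @ \oo --> x%:E.
  by apply: cvg_EFin; [exact: nearW|exact: cS].
by rewrite (cvg_limn_einf_sup cES).2.
Qed.

Lemma coin_value_unif01 (E : set R) : measurable E ->
  coin_prob (coin_value @^-1` E) = unif01 (E : set TR).
Proof.
move=> mE; rewrite coin_probE /unif01 /mrestr.
congr (lebesgue_measure _); apply/seteqP; split => x [Ex /[dup] x01].
  rewrite /= in_itv/= => /coin_value_binary_digits vx; split => //.
  by rewrite /preimage/= vx in Ex.
rewrite /= in_itv/= => /coin_value_binary_digits vx; split => //.
by rewrite /preimage/= vx.
Qed.

End coin_value.

(** * A sampler on the coin space, for any proposal given by a quantile *)

Section existence.
Context {R : realType}.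
Notation TR := (measurableTypeR R).
Notation mu := (@lebesgue_measure R).
Variables q a quantile : R -> R.
Hypotheses (pdfq : is_pdf q) (ma : measurable_fun [set: R] a).
Hypothesis a01 : forall r, 0 <= a r <= 1.
Hypothesis mquantile : measurable_fun [set: R] quantile.
Hypothesis quantile_law : forall E : set R, measurable E ->
  unif01 (quantile @^-1` E : set TR) = law_of_density q E.

Let rho0 (w : coin_space) : R := quantile (coin_value (even_coins w)).
Let unif0 (w : coin_space) : TR := coin_value (odd_coins w).
Let acc0 (w : coin_space) : bool := (unif0 w : R) <= a (rho0 w).

Let mrho0 : measurable_fun [set: coin_space] rho0.
Proof.
apply: (measurableT_comp mquantile); apply: (measurableT_comp measurable_coin_value).
exact: measurable_even_coins.
Qed.

Let munif0 : measurable_fun [set: coin_space] unif0.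
Proof.
by apply: (measurableT_comp measurable_coin_value); exact: measurable_odd_coins.
Qed.

Let macc0 : measurable_fun [set: coin_space] acc0.
Proof.
apply: measurable_fun_ler; first exact: munif0.
exact: (measurableT_comp ma mrho0).
Qed.

Let P := @coin_prob R.

Let rho0_RV : {RV P >-> R} := HB.pack rho0 (isMeasurableFun.Build _ _ _ _ _ mrho0).

Let mquant E : measurable E -> measurable (quantile @^-1` E).
Proof. by move=> mE; rewrite -[X in measurable X]setTI; exact: mquantile. Qed.

Let mval E : measurable E -> measurable (coin_value (R := R) @^-1` E).
Proof.
by move=> mE; rewrite -[X in measurable X]setTI; exact: measurable_coin_value.
Qed.

Let even_prob A : measurable A -> P (even_coins @^-1` A) = P A.
Proof.
move=> mA; have := @even_odd_coins_indep R A setT mA measurableT.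
by rewrite preimage_setT setIT probability_setT mule1.
Qed.

Let rho0_law E : measurable E -> P (rho0 @^-1` E) = law_of_density q E.
Proof.
move=> mE; rewrite -quantile_law// -coin_value_unif01; last exact: mquant.
exact: (even_prob (mval (mquant mE))).
Qed.

Let rho0_unif0 (E : set R) (F : set TR) : measurable E -> measurable F ->
  P (rho0 @^-1` E `&` unif0 @^-1` F) = (P (rho0 @^-1` E) * unif01 F)%E.
Proof.
move=> mE mF.
rewrite -[unif01 F]coin_value_unif01//.
rewrite -[P (rho0 @^-1` E)](esym (even_prob (mval (mquant mE)))).
exact: (@even_odd_coins_indep R _ _ (mval (mquant mE)) (mval mF)).
Qed.

Let joint (w : coin_space) : R * TR := (rho0 w, unif0 w).

Let mjoint : measurable_fun [set: coin_space] joint.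
Proof. exact: measurable_fun_pair. Qed.

Let accept_set (E : set R) : set (R * TR) :=
  [set z | E z.1 /\ ((z.2 : R) <= a z.1) = true].

Let maccept_set E : measurable E -> measurable (accept_set E).
Proof.
move=> mE; rewrite (_ : accept_set E = (E `*` setT) `&`
  (setT `&` (fun z : R * TR => (z.2 : R) <= a z.1) @^-1` [set true])); last first.
  by apply/seteqP; split => z /=; [move=> [? ?]|move=> [[? _] [_ ?]]].
apply: measurableI; first exact: measurableX.
have mle : measurable_fun [set: R * TR] (fun z : R * TR => (z.2 : R) <= a z.1).
  apply: measurable_fun_ler; first exact: measurable_snd.
  exact: (measurableT_comp ma measurable_fst).
exact: mle.
Qed.

(** The pair ([rho0], [unif0]) has a product law, by uniqueness of the product measure. The slice of
    the acceptance set at r in E is the event that a uniform variable is at most a r, of probability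
    a r. *)
Let round0_law E : measurable E ->
  P (rho0 @^-1` E `&` acc0 @^-1` [set true]) = law_of_density (fun r => a r * q r) E.
Proof.
move=> mE.
rewrite -(@integral_distribution_density R q a pdfq ma a01 _ _ P rho0_RV)//.
have -> : rho0 @^-1` E `&` acc0 @^-1` [set true] = joint @^-1` accept_set E by [].
have := @product_measure_unique _ _ R TR R (distribution P rho0_RV) unif01
  (pushforward P joint) _ _ (maccept_set mE).
move=> /(_ mjoint) H; rewrite -[LHS]H; last by move=> C D mC mD; exact: rho0_unif0.
rewrite /product_measure1 [RHS]integral_mkcond; apply: eq_integral => r _ /=.
rewrite patchE; case: ifPn => [|]; rewrite (inE, notin_setE) => Er.
  rewrite -unif01_itv0c//; congr unif01; apply/seteqP; split => y.
    by rewrite /xsection/= inE/= in_itv/= => -[].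
  by rewrite /xsection/= inE/= in_itv/=.
rewrite (_ : xsection _ _ = set0) ?measure0//.
by apply/seteqP; split => // y; rewrite /xsection/= inE => -[].
Qed.

Let round0 (w : coin_space) : R * bool := (rho0 w, acc0 w).
(** Round n spends the even half of what remains after n passages to the odd half, so distinct
    rounds use disjoint coins. *)
Let round_n n (w : coin_space) : R * bool := round0 (even_coins (iter n odd_coins w)).

Let mround0 : measurable_fun [set: coin_space] round0.
Proof. exact: measurable_fun_pair. Qed.

Let mround_even : measurable_fun [set: coin_space] (round0 \o even_coins).
Proof. exact: (measurableT_comp mround0 measurable_even_coins). Qed.

Let round_even_indep A B : measurable A -> measurable B ->
  P ((round0 \o even_coins) @^-1` A `&` odd_coins @^-1` B) =
  (P ((round0 \o even_coins) @^-1` A) * P B)%E.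
Proof.
move=> mA mB.
have mA0 : measurable (round0 @^-1` A).
  by rewrite -[X in measurable X]setTI; exact: mround0.
rewrite -[P (_ @^-1` A)](esym (even_prob mA0)).
exact: (@even_odd_coins_indep R _ _ mA0 mB).
Qed.

Let mround_n n : measurable_fun [set: coin_space] (round_n n).
Proof.
apply: (measurableT_comp mround_even); apply: measurable_iter.
exact: measurable_odd_coins.
Qed.

Let round_n_prob n A : measurable A -> P (round_n n @^-1` A) = P (round0 @^-1` A).
Proof.
move=> mA; rewrite -[LHS]/(P ((fun w =>
  (round0 \o even_coins) (iter n odd_coins w)) @^-1` A)).
rewrite (iter_preimage_prob mround_even measurable_odd_coins round_even_indep)//.
apply: (@even_prob (round0 @^-1` A)).
by rewrite -[X in measurable X]setTI; exact: mround0.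
Qed.

Let mrho n : measurable_fun [set: coin_space] (fun w => (round_n n w).1).
Proof. exact: (measurableT_comp measurable_fst (mround_n n)). Qed.

Let macc n : measurable_fun [set: coin_space] (fun w => (round_n n w).2).
Proof. exact: (measurableT_comp measurable_snd (mround_n n)). Qed.

Lemma rejection_sampler_exists :
  exists (rho : nat -> {RV P >-> R}) (acc : nat -> {RV P >-> bool}),
    rejection_sampler q a rho acc.
Proof.
pose rho n : {RV P >-> R} :=
  HB.pack (fun w => (round_n n w).1) (isMeasurableFun.Build _ _ _ _ _ (mrho n)).
pose acc n : {RV P >-> bool} :=
  HB.pack (fun w => (round_n n w).2) (isMeasurableFun.Build _ _ _ _ _ (macc n)).
exists rho, acc.
split => [n|]; last first.
  exact: (mutually_independent_iter mround_even measurable_odd_coins round_even_indep).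
have lrho E : measurable E ->
    P ((fun w => (round_n n w).1) @^-1` E) = law_of_density q E.
  move=> mE; rewrite -rho0_law//.
  have := @round_n_prob n (E `*` setT) (measurableX mE measurableT).
  rewrite (_ : round0 @^-1` _ = rho0 @^-1` E); last first.
    by apply/seteqP; split => w //= [].
  by rewrite (_ : round_n n @^-1` _ = (fun w => (round_n n w).1) @^-1` E)//;
    apply/seteqP; split => w //= [].
split => // E mE.
rewrite (@integral_distribution_density _ q a pdfq ma a01 _ _ P (rho n))//.
rewrite -round0_law//.
have m1 : measurable [set true] by [].
exact: (@round_n_prob n (E `*` [set true]) (measurableX mE m1)).
Qed.

End existence.

(** * The law of a density as a measure *)

Section law_measure.
Context {R : realType}.
Notation TR := (measurableTypeR R).
Notation mu := (@lebesgue_measure R).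

(* The unused argument [pdfq] lets the measure instance below depend on it. *)
Definition law_measure (q : R -> R) (pdfq : is_pdf q) : set TR -> \bar R :=
  law_of_density q.

Variables (q : R -> R) (pdfq : is_pdf q).

Let law0 : law_measure pdfq set0 = 0%E.
Proof. exact: integral_set0. Qed.

Let law_ge0 E : (0 <= law_measure pdfq E)%E.
Proof. by have [_ q0 _] := pdfq; apply: integral_ge0 => r _; rewrite lee_fin. Qed.

Let law_sigma_additive : semi_sigma_additive (law_measure pdfq).
Proof.
have [mq q0 _] := pdfq.
move=> F mF tF mUF; rewrite /law_measure /law_of_density.
rewrite ge0_integral_bigcup//=; last first.
- by move=> r _; rewrite lee_fin.
- by apply: measurable_funTS; exact/measurable_EFinP.
apply: is_cvg_ereal_nneg_natsum_cond => n _ _.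
by apply: integral_ge0 => r _; rewrite lee_fin.
Qed.

HB.instance Definition _ := isMeasure.Build _ _ _ (law_measure pdfq)
  law0 law_ge0 law_sigma_additive.

End law_measure.

(** * The quantile of the truncated power law *)

Section quantile.
Context {R : realType}.
Notation TR := (measurableTypeR R).
Notation mu := (@lebesgue_measure R).
Variables alpha tau : R.
Hypotheses (alpha_gt0 : 0 < alpha) (tau_gt0 : 0 < tau).

(** This inverts the survival function r -> (r / tau)^(-alpha) on r >= tau: v is an upper tail
    probability, so the map decreases. *)
Definition power_quantile (v : R) : R := tau * v `^ (- alpha^-1).

Lemma measurable_power_quantile : measurable_fun [set: R] power_quantile.
Proof. by apply: measurable_funM => //; exact: measurable_powR. Qed.

Lemma powRN_le (u c : R) : 0 < u -> 0 < c ->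
  (u `^ (- alpha) <= c `^ (- alpha)) = (c <= u).
Proof.
move=> u0 c0; rewrite [leLHS]powRN [leRHS]powRN lef_pV2 ?posrE ?powR_gt0//.
apply/idP/idP; last by move=> cu; apply: ge0_ler_powR; rewrite ?nnegrE// ltW.
by apply: contraTT; rewrite -!ltNge => uc; rewrite gt0_ltr_powR// nnegrE ltW.
Qed.

Lemma power_quantile_ge (v x : R) : 0 < v <= 1 ->
  (x <= power_quantile v) = (v <= (Num.max x tau / tau) `^ (- alpha)).
Proof.
move=> /andP[v0 v1].
set u := v `^ (- alpha^-1).
have u0 : 0 < u by exact: powR_gt0.
have vE : v = u `^ (- alpha).
  by rewrite /u -powRrM mulrNN mulVf ?gt_eqF// powRr1// ltW.
have m0 : 0 < Num.max x tau by rewrite lt_max tau_gt0 orbT.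
(* Since v <= 1, the value tau u is at least tau, so comparing it with the maximum of x and tau is
   comparing it with x. *)
have u1 : 1 <= u.
  by rewrite -powRN_le// -vE powR1.
rewrite [in RHS]vE powRN_le// ?divr_gt0// ler_pdivrMr// ge_max mulrC.
by rewrite ler_peMr ?(ltW tau_gt0)// andbT.
Qed.

Lemma power_quantile_law (E : set R) : measurable E ->
  unif01 (power_quantile @^-1` E : set TR) =
  law_of_density (proposal_density alpha tau) E.
Proof.
move=> mE; have pdfq := is_pdf_proposal_density alpha_gt0 tau_gt0.
pose f : TR -> TR := power_quantile.
have mf : measurable_fun [set: TR] f by exact: measurable_power_quantile.
pose m1 := pushforward unif01 f.
pose m2 := law_measure pdfq.
rewrite -[RHS]/(m2 E).
apply: (@eq_measure_closed_rays R m1 m2) => //.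
- move=> x; rewrite [RHS](law_of_proposal_tail alpha_gt0 tau_gt0).
  set b := (Num.max x tau / tau) `^ (- alpha).
  have b1 : b <= 1.
    have p1 : 1 `^ (- alpha) = 1 :> R by rewrite powR1.
    rewrite -[leRHS]p1 powRN_le// ?divr_gt0 ?lt_max ?tau_gt0 ?orbT//.
    by rewrite ler_pdivlMr// mul1r le_max lexx orbT.
  rewrite -unif01_itv0c ?powR_ge0//.
  rewrite [LHS]/(mu ((f @^-1` `[x, +oo[) `&` `]0, 1])) /unif01 /mrestr.
  congr (mu _); apply/seteqP; split => v /=; rewrite !in_itv/= andbT => -[+ v01].
    by rewrite /f power_quantile_ge.
  by rewrite -power_quantile_ge.
- move=> x; apply: le_lt_trans (ltry 1).
  have mS : measurable (f @^-1` `[x, +oo[%classic).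
    by rewrite -[X in measurable X]setTI; exact: mf.
  exact: (probability_le1 (@unif01 R) mS).
Qed.

End quantile.

(** * The bound, the one-round law and the exact sampler together *)

Theorem theorem4p6 (R : realType) (alpha tau sigma A B X : R)
    (alpha_gt0 : 0 < alpha) (alpha_lt2 : alpha < 2) (tau_gt0 : 0 < tau)
    (sigma_gt0 : 0 < sigma) (A_lt0 : A < 0) :
  let C := tilt_C sigma A B X in
  let M := tilt_M A B X in
  let q := proposal_density alpha tau in
  let target := tilted_density alpha tau sigma A B X in
  let a := acceptance_probability sigma A B X in
  (forall r, 0 < r ->
     (@lebesgue_measure R).-integrable [set: R]
       (EFin \o tilt_integrand sigma A B X r) /\
     C r <= M) /\
  (is_pdf q /\ is_pdf target) /\
  (forall r, 0 < r -> 0 <= a r <= 1) /\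
  (forall (d : measure_display) (T : measurableType d) (P : probability T R)
     (rho : {RV P >-> R}) (acc : {RV P >-> bool}),
     proposal_round q a rho acc ->
     (0 < P (acc @^-1` [set true]))%E /\
     forall E : set R, measurable E ->
       conditional_probability P (rho @^-1` E) (acc @^-1` [set true]) =
       law_of_density target E) /\
  (exists (d : measure_display) (T : measurableType d) (P : probability T R)
     (rho : nat -> {RV P >-> R}) (acc : nat -> {RV P >-> bool}),
     rejection_sampler q a rho acc) /\
  (forall (d : measure_display) (T : measurableType d) (P : probability T R)
     (rho : nat -> {RV P >-> R}) (acc : nat -> {RV P >-> bool}),
     rejection_sampler q a rho acc ->
     [/\ P [set w | exists n, acc n w] = 1%E,
         measurable_fun [set: T] (sampler_output rho acc) &
         forall E : set R, measurable E ->
           P (sampler_output rho acc @^-1` E) = law_of_density target E]).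
Proof.
move=> C M q target a.
have pdfq : is_pdf q by exact: is_pdf_proposal_density.
have ma : measurable_fun [set: R] a by exact: measurable_acceptance_probability.
have a01 r : 0 <= a r <= 1 by exact: acceptance_probability_itv.
have aq_gt0 : 0 < \int[lebesgue_measure]_r (a r * q r).
  exact: Rintegral_accepted_density_gt0.
have targetE : target = normalized (fun r => a r * q r) by exact: tilted_densityE.
split; first by move=> r _; split; [exact: integrable_tilt_integrand|exact: tilt_C_le].
split; first by split => //; exact: is_pdf_tilted_density.
split; first by move=> r _; exact: a01.
split.
  move=> d T P rho acc rnd; split.
    exact: (round_accept_gt0 pdfq ma a01 aq_gt0 rnd).
  by move=> E mE; rewrite targetE (round_conditional_law pdfq ma a01 aq_gt0 rnd mE).
split.
  exists _, coin_space, (@coin_prob R).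
  exact: (rejection_sampler_exists pdfq ma a01 (measurable_power_quantile alpha tau)
    (power_quantile_law alpha_gt0 tau_gt0)).
move=> d T P rho acc rs; split.
- exact: (sampler_accepts pdfq ma a01 aq_gt0 rs).
- exact: measurable_sampler_output.
- by move=> E mE; rewrite targetE (sampler_output_law pdfq ma a01 aq_gt0 rs mE).
Qed.
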